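(* Let $V$ be a finite set, $v_0\notin V$, $d\geq 0$ an integer, and let $\mathscr{O}$ be an oriented matroid on the set of elements $V\sqcup\{v_0\}$ of rank at most $d$. Suppose that $r\geq d+1$ and that $U_1,\ldots,U_r\subseteq V$ are pairwise disjoint nonempty subsets of $V$ such that $v_0\in\bigcap_{1\leq i<j\leq r}\operatorname{conv}(U_i\cup U_j)$. Then there exist $u_1\in U_1,\ldots,u_r\in U_r$ such that $v_0\in\operatorname{conv}(\{u_1,\ldots,u_r\})$.
   Context: Let $E$ be a finite set. A sign vector on $E$ is a function $\Phi\colon E\to\{-,0,+\}$; write $\Phi^{+}=\Phi^{-1}(+)$, $\Phi^{-}=\Phi^{-1}(-)$, $0$ for the all-zero sign vector, $-\Phi$ for the coordinatewise negation, $(\Phi\circ\Psi)(e)=\Phi(e)$ if $\Phi(e)\ne0$ and $\Psi(e)$ otherwise, and $S(\Phi,\Psi)=(\Phi^+\cap\Psi^-)\cup(\Phi^-\cap\Psi^+)$. An oriented matroid $\mathscr{O}$ on the set of elements $E$ is given by a set $\mathscr{L}(\mathscr{O})$ of sign vectors on $E$ (its covectors) such that: $0\in\mathscr{L}(\mathscr{O})$; $-\Phi\in\mathscr{L}(\mathscr{O})$ iff $\Phi\in\mathscr{L}(\mathscr{O})$; $\Phi\circ\Psi\in\mathscr{L}(\mathscr{O})$ for all $\Phi,\Psi\in\mathscr{L}(\mathscr{O})$; and for all $\Pi,\Xi\in\mathscr{L}(\mathscr{O})$ and $v\in\Pi^+\cap\Xi^-$ there is $\Theta\in\mathscr{L}(\mathscr{O})$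 with $\Theta(v)=0$ and $\Theta(w)=(\Pi\circ\Xi)(w)$ for all $w\in E-S(\Pi,\Xi)$. Two sign vectors $\Phi,\Psi$ are orthogonal if: there is $v$ with $\Phi(v)=\Psi(v)\neq0$ if and only if there is $w$ with $\Phi(w)=-\Psi(w)\neq0$. A vector of $\mathscr{O}$ is a sign vector orthogonal to every covector; $\mathscr{V}(\mathscr{O})$ is the set of vectors. The rank of $\mathscr{O}$ is the usual one: the maximal $k$ for which there is a chain $0<\Phi_1<\dots<\Phi_k$ in $\mathscr{L}(\mathscr{O})$ for the coordinatewise order induced by $0<-$, $0<+$ (with $-,+$ incomparable). For $U\subseteq E$, $\operatorname{conv}(U):=U\cup\{v\in E-U:\ \Phi^+\subseteq U\text{ and }\Phi^-=\{v\}\text{ for some }\Phi\in\mathscr{V}(\mathscr{O})\}$. *)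

(* Defs.v *)
From HB Require Import structures.
From mathcomp Require Import all_boot.

Set Implicit Arguments.
Unset Strict Implicit.
Unset Printing Implicit Defensive.

Inductive sign := Neg | Zero | Pos.

Definition bool_of_sign (s : sign) : option bool :=
  match s with Neg => Some false | Zero => None | Pos => Some true end.

Definition sign_of_bool (b : option bool) : sign :=
  match b with Some false => Neg | None => Zero | Some true => Pos end.

Lemma bool_of_signK : cancel bool_of_sign sign_of_bool.
Proof. by case. Qed.

HB.instance Definition _ := Countable.copy sign (can_type bool_of_signK).
HB.instance Definition _ : isFinite sign := CanIsFinite bool_of_signK.

Definition sign_opp (s : sign) : sign :=
  match s with Neg => Pos | Zero => Zero | Pos => Neg end.

(* Only [Zero] lies below other signs; [Neg] and [Pos] are incomparable. *)
Definition sign_le (s t : sign) : bool := (s == Zero) || (s == t).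

Notation signvec E := {ffun E -> sign}.

Section SignVectors.
Variable E : finType.
Implicit Types Phi Psi : signvec E.

Definition sv0 : signvec E := [ffun=> Zero].

Definition sv_opp Phi : signvec E := [ffun e => sign_opp (Phi e)].

Definition sv_comp Phi Psi : signvec E :=
  [ffun e => if Phi e != Zero then Phi e else Psi e].

Definition sv_pos Phi : {set E} := [set e | Phi e == Pos].

Definition sv_neg Phi : {set E} := [set e | Phi e == Neg].

Definition sv_sep Phi Psi : {set E} :=
  (sv_pos Phi :&: sv_neg Psi) :|: (sv_neg Phi :&: sv_pos Psi).

Definition sv_orth Phi Psi : bool :=
  [exists v, (Phi v == Psi v) && (Psi v != Zero)] ==
  [exists w, (Phi w == sign_opp (Psi w)) && (sign_opp (Psi w) != Zero)].

Definition sv_lt Phi Psi : bool :=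
  (Phi != Psi) && [forall e, sign_le (Phi e) (Psi e)].

Lemma sv_lt_irr : irreflexive sv_lt.
Proof. by move=> Phi; rewrite /sv_lt eqxx. Qed.

Lemma sv_lt_trans : transitive sv_lt.
Proof.
move=> B A C /andP[nAB /forallP lAB] /andP[_ /forallP lBC]; apply/andP; split.
  apply: contraNneq nAB => eAC; apply/eqP/ffunP => e.
  have := lAB e; have := lBC e; rewrite -eAC /sign_le.
  by case: (A e); case: (B e).
apply/forallP => e; have := lAB e; have := lBC e; rewrite /sign_le.
by case: (A e); case: (B e); case: (C e).
Qed.

End SignVectors.

Record oriented_matroid (E : finType) := OrientedMatroid {
  covectors : {set signvec E};
  covector0 : sv0 E \in covectors;
  covector_opp : forall Phi : signvec E,
    sv_opp Phi \in covectors <-> Phi \in covectors;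
  covector_comp : forall Phi Psi : signvec E,
    Phi \in covectors -> Psi \in covectors -> sv_comp Phi Psi \in covectors;
  covector_elim : forall (Pi Xi : signvec E) (v : E),
    Pi \in covectors -> Xi \in covectors -> v \in sv_pos Pi :&: sv_neg Xi ->
    exists2 Theta : signvec E, Theta \in covectors &
      Theta v = Zero /\
      (forall w : E, w \notin sv_sep Pi Xi -> Theta w = sv_comp Pi Xi w)
}.

Section OrientedMatroid.
Variables (E : finType) (O : oriented_matroid E).

Definition vectors : {set signvec E} :=
  [set Phi | [forall Psi in covectors O, sv_orth Phi Psi]].

(* There is a chain 0 < Phi_1 < ... < Phi_k of covectors. *)
Definition covector_chain (k : nat) : bool :=
  [exists s : k.-tuple (signvec E),
     path (@sv_lt E) (sv0 E) s && all [in covectors O] s].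

Lemma covector_chain_ex : exists k, covector_chain k.
Proof. by exists 0; apply/existsP; exists [tuple]. Qed.

Lemma covector_chain_bound k : covector_chain k -> k <= #|{: signvec E}|.
Proof.
case/existsP=> s /andP[/path_sorted s_sorted _].
have s_uniq := sorted_uniq (@sv_lt_trans E) (@sv_lt_irr E) s_sorted.
by rewrite -(size_tuple s) -(card_uniqP s_uniq) max_card.
Qed.

Definition om_rank : nat := ex_maxn covector_chain_ex covector_chain_bound.

Definition conv (U : {set E}) : {set E} :=
  U :|: [set v | (v \notin U) &&
           [exists Phi in vectors,
              (sv_pos Phi \subset U) && (sv_neg Phi == [set v])]].

End OrientedMatroid.

(* Main.v *)
Require Import Defs.
From mathcomp Require Import all_boot all_algebra.

Set Implicit Arguments.
Unset Strict Implicit.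
Unset Printing Implicit Defensive.

Import GRing.Theory.

(** Read covectors f with f(v0) = + as the points of an affine arrangement, and
    let A(N) be the set of those that are nonpositive on N.  By elimination
    against a minimal obstruction (conv_of_cuts), v0 lies in the convex hull of
    a set S as soon as A(S) is empty; conversely (conv_cut) the hypothesis says
    that a point f of the arrangement cannot be nonpositive on two classes U_i
    and U_j, so that at most one of the r classes has no positive element at f.

    Suppose that A(u_1, ..., u_r) is nonempty for every transversal.  Let C be
    the order complex of all points, and J the complex of partial transversals.
    Three facts on homology modulo 2 are needed.
    - The order complex of the points satisfying any system of weak sign
      conditions is acyclic if it is nonempty (acyclic_region): cut it along an
      element taking both signs, apply Mayer-Vietoris, the common part being
      nonempty by the elimination axiom; when nothing is left to cut, there is
      a greatest covector.
    - The union of the A(u), u in t, is therefore acyclic for every nonempty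
      partial transversal t (acyclic_union_flag): all intersections are
      nonempty.
    - The partial transversals inside a set meeting k classes form an acyclic
      complex in dimensions below k - 1 (acyclic_partial_transversal).
    Acyclic carriers then give two augmentation-preserving chain maps: Psi from
    C to J, sending a flag s to partial transversals made of elements that are
    positive somewhere on s, and Phi from J to C, sending t to flags contained
    in some A(u) with u in t.  Psi exists because flags have at most d elements
    by the rank bound, whereas at least r - 1 >= d classes have positive
    elements at any point.

    The composite of Phi after Psi is a self-map of the acyclic complex C, so
    its trace, the empty simplex included, vanishes modulo 2
    (trace_acyclic_eq0, the Lefschetz fixed point theorem).  Yet its diagonal
    coefficient is 1 at the empty simplex and 0 at every nonempty flag s: if s
    occurred in the image of s, some u would be both positive somewhere on s
    and nonpositive on all of s.  This contradiction proves the theorem. *)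

(** * Simplicial chains modulo 2 *)

Section Chains.
Local Open Scope ring_scope.

(* Chains are ungraded and augmented: the empty set is a simplex, and bool is
   the field with two elements.  Grading is imposed by the predicate supported,
   which counts vertices, so that degree n means dimension n - 1. *)

Local Notation chain X := {ffun {set X} -> bool}.

Definition bd (X : finType) (z : chain X) : chain X :=
  [ffun s : {set X} => \sum_(x | x \notin s) z (x |: s)].

(** The right-hand side of the chain map equation bd (F s) = pull F s. *)
Definition pull (X Y : finType) (F : {set X} -> chain Y) (s : {set X}) :
  chain Y := \sum_(x in s) F (s :\ x).

Definition extend (X Y : finType) (F : {set X} -> chain Y) (z : chain X) :
  chain Y := \sum_(s | z s) F s.

(** The empty simplex, generator of degree 0. *)
Definition pt (X : finType) : chain X := [ffun s : {set X} => s == set0].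

Definition supported (X : finType) (D : pred {set X}) n (z : chain X) :=
  forall s, z s -> D s /\ #|s| = n.

Definition acyclic_at (X : finType) (D : pred {set X}) n :=
  forall z, supported D n z -> bd z = 0 ->
  exists2 y, supported D n.+1 y & bd y = z.

Definition down_closed (X : finType) (D : pred {set X}) :=
  forall s t : {set X}, s \subset t -> D t -> D s.

Lemma chain_addrr (X : finType) (z : chain X) : z + z = 0.
Proof. by apply/ffunP => s; rewrite !ffunE; apply: addbb. Qed.

Lemma addr_eq0_chain (X : finType) (z w : chain X) : z + w = 0 -> z = w.
Proof. by move=> h; rewrite -[LHS]addr0 -(chain_addrr w) addrA h add0r. Qed.

Lemma sum_bool_true (I : finType) (P : pred I) (F : I -> bool) :
  \sum_(i | P i) F i -> exists2 i, P i & F i.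
Proof.
case: (pickP (fun i => P i && F i)) => [i /andP[]|h]; first by exists i.
by rewrite big1 // => i Pi; have := h i; rewrite Pi.
Qed.

Lemma sum_chainE (I : finType) (P : pred I) (X : finType) (F : I -> chain X) s :
  (\sum_(i | P i) F i) s = \sum_(i | P i) F i s.
Proof. by rewrite sum_ffunE. Qed.

(** Both sides run over all incident pairs of a simplex and a facet of it; this
    is the adjunction between boundary and coboundary. *)
Lemma sum_faces (V : zmodType) (X : finType) (F : X -> {set X} -> {set X} -> V) :
  \sum_(s : {set X}) \sum_(x in s) F x (s :\ x) s =
  \sum_(s : {set X}) \sum_(x | x \notin s) F x s (x |: s).
Proof.
rewrite (exchange_big_dep xpredT) //= [RHS](exchange_big_dep xpredT) //=.
apply: eq_bigr => x _.
rewrite (reindex_onto (fun s : {set X} => x |: s) (fun s => s :\ x)) /=; last first.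
  by move=> s xs; rewrite setD1K.
have E s : (x \in x |: s) && ((x |: s) :\ x == s) = (x \notin s).
  rewrite setU11 /=; apply/eqP/idP => [<-|xs]; first by rewrite !inE eqxx.
  by rewrite setU1K.
by apply: eq_big => [s|s]; rewrite E // => xs; rewrite setU1K.
Qed.

(** In characteristic 2 the terms at (x, y) and (y, x) cancel.  This gives both
    bd_bd and pull_pull. *)
Lemma sum_sym (V : zmodType) (I : finType) (P : rel I) (F : I -> I -> V) :
  (forall v : V, v + v = 0) -> irreflexive P -> symmetric P ->
  (forall x y, F x y = F y x) ->
  \sum_x \sum_(y | P x y) F x y = 0.
Proof.
move=> V2 Pirr Psym Fsym.
(* An arbitrary order on I selects one representative of each pair. *)
pose lt (x y : I) := (enum_rank x < enum_rank y)%N.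
have split_lt x : \sum_(y | P x y) F x y =
    \sum_(y | P x y && lt x y) F x y + \sum_(y | P x y && lt y x) F x y.
  rewrite (bigID (lt x)) /=; congr (_ + _); apply: eq_bigl => y.
  have [->|ne] := eqVneq x y; first by rewrite Pirr.
  congr (_ && _); rewrite /lt -leqNgt leq_eqVlt.
  by rewrite (inj_eq val_inj) (inj_eq enum_rank_inj) eq_sym (negPf ne).
rewrite (eq_bigr _ (fun x _ => split_lt x)) big_split /=.
rewrite [X in _ + X](exchange_big_dep xpredT) //=.
rewrite -[RHS](V2 (\sum_x \sum_(y | P x y && lt x y) F x y)).
congr (_ + _); apply: eq_bigr => x _; apply: eq_big => [y|y _]; last exact: Fsym.
by rewrite Psym.
Qed.

Lemma bdD (X : finType) (z w : chain X) : bd (z + w) = bd z + bd w.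
Proof.
apply/ffunP => s; rewrite !ffunE -big_split /=.
by apply: eq_bigr => x _; rewrite !ffunE.
Qed.

Lemma bd0 (X : finType) : bd (0 : chain X) = 0.
Proof. by apply/ffunP => s; rewrite !ffunE big1 // => x _; rewrite ffunE. Qed.

Lemma bd_sum (I : finType) (P : pred I) (X : finType) (F : I -> chain X) :
  bd (\sum_(i | P i) F i) = \sum_(i | P i) bd (F i).
Proof. exact: (big_morph _ (@bdD X) (@bd0 X)). Qed.

Lemma bd_bd (X : finType) (z : chain X) : bd (bd z) = 0.
Proof.
apply/ffunP => s; rewrite !ffunE.
under eq_bigr => x _ do rewrite ffunE.
rewrite big_mkcond /=.
rewrite -[RHS](@sum_sym bool X (fun x y => [&& x \notin s, y \notin s & x != y])
   (fun x y => z (y |: (x |: s)))) //=.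
- apply: eq_bigr => x _; case: ifP => xs; last by rewrite big_pred0.
  by apply: eq_bigl => y; rewrite !inE negb_or eq_sym andbC.
- by case.
- by move=> x; rewrite eqxx !andbF.
- by move=> x y; rewrite eq_sym andbCA.
- by move=> x y; rewrite setUCA.
Qed.

Lemma pull_pull (X Y : finType) (F : {set X} -> chain Y) s : pull (pull F) s = 0.
Proof.
rewrite /pull big_mkcond /=.
rewrite -[RHS](@sum_sym (chain Y) X (fun x y => [&& x \in s, y \in s & x != y])
   (fun x y => F (s :\ x :\ y))) //=.
- apply: eq_bigr => x _; case: ifP => xs; last by rewrite big_pred0.
  by apply: eq_bigl => y; rewrite !inE eq_sym andbC.
- exact: chain_addrr.
- by move=> x; rewrite eqxx !andbF.
- by move=> x y; rewrite eq_sym andbCA.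
- by move=> x y; rewrite !setDDl setUC.
Qed.

(** A family with bd (F s) = pull F s thus extends linearly to a chain map. *)
Lemma extend_pull (X Y : finType) (F : {set X} -> chain Y) z :
  extend (pull F) z = extend F (bd z).
Proof.
rewrite /extend /pull big_mkcond [RHS]big_mkcond /=.
transitivity (\sum_(s : {set X}) \sum_(x in s) (if z s then F (s :\ x) else 0)).
  by apply: eq_bigr => s _; case: ifP => // _; rewrite big1.
rewrite (sum_faces (fun _ t s => if z s then F t else 0)).
apply: eq_bigr => s _; rewrite ffunE.
pose f (b : bool) : chain Y := if b then F s else 0.
have fD : {morph f : a b / a + b >-> a + b}.
  by move=> [] []; rewrite /f /= ?addr0 ?add0r ?chain_addrr.
have f0 : f 0 = 0 by [].
by rewrite -/(f _) (big_morph f fD f0).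
Qed.

Lemma extendD (X Y : finType) (F : {set X} -> chain Y) z w :
  extend F (z + w) = extend F z + extend F w.
Proof.
rewrite /extend big_mkcond [X in _ = X + _]big_mkcond [X in _ = _ + X]big_mkcond.
rewrite -big_split /=; apply: eq_bigr => s _; rewrite ffunE.
by case: (z s) (w s) => [] [] /=; rewrite ?addr0 ?add0r ?chain_addrr.
Qed.

Lemma extend0 (X Y : finType) (F : {set X} -> chain Y) : extend F 0 = 0.
Proof. by rewrite /extend big_pred0 // => s; rewrite ffunE. Qed.

Lemma extend_sum (I : finType) (P : pred I) (X Y : finType) (F : {set X} -> chain Y) 
    (z : I -> chain X) :
  extend F (\sum_(i | P i) z i) = \sum_(i | P i) extend F (z i).
Proof. exact: (big_morph _ (@extendD _ _ F) (@extend0 _ _ F)). Qed.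

Lemma bd_extend (X Y : finType) (F : {set X} -> chain Y) z :
  bd (extend F z) = extend (fun s => bd (F s)) z.
Proof. exact: bd_sum. Qed.

Lemma bd_pt (X : finType) : bd (pt X) = 0.
Proof.
apply/ffunP => s; rewrite !ffunE big1 // => x _; rewrite ffunE.
by apply/negbTE/set0Pn; exists x; rewrite setU11.
Qed.

Lemma extend_pt (X Y : finType) (F : {set X} -> chain Y) : extend F (pt X) = F set0.
Proof. by rewrite /extend (big_pred1 set0) // => s; rewrite ffunE. Qed.

Lemma supported_pt (X : finType) (D : pred {set X}) : D set0 -> supported D 0 (pt X).
Proof. by move=> D0 s; rewrite ffunE => /eqP->; rewrite cards0. Qed.

Lemma supportedD (X : finType) (D : pred {set X}) n z w :
  supported D n z -> supported D n w -> supported D n (z + w).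
Proof.
move=> hz hw s; rewrite ffunE => h.
by case: (boolP (z s)) => [/hz|zs] //; apply: hw; move: h; rewrite (negPf zs).
Qed.

Lemma supported_sum (I : finType) (P : pred I) (X : finType) (D : pred {set X}) n
    (F : I -> chain X) :
  (forall i, P i -> supported D n (F i)) ->
  supported D n (\sum_(i | P i) F i).
Proof. by move=> h s; rewrite sum_chainE => /sum_bool_true[i Pi /(h i Pi)]. Qed.

Lemma supported_bd (X : finType) (D : pred {set X}) n z :
  down_closed D -> supported D n.+1 z -> supported D n (bd z).
Proof.
move=> Dd hz s; rewrite ffunE => /sum_bool_true[x xs /hz[Dx cx]].
split; first by apply: Dd Dx; apply: subsetUr.
by move: cx; rewrite cardsU1 xs => -[].
Qed.

Lemma eq_acyclic_at (X : finType) (D D' : pred {set X}) n :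
  D =1 D' -> acyclic_at D n -> acyclic_at D' n.
Proof.
move=> eD h z hz bz; have [|y hy by_] := h z _ bz.
  by move=> s /hz; rewrite eD.
by exists y => // s /hy; rewrite eD.
Qed.

(** If a can be added to every simplex, joining with a is a contraction. *)
Lemma acyclic_cone (X : finType) (D : pred {set X}) a n :
  (forall s, D s -> D (a |: s)) -> acyclic_at D n.
Proof.
move=> Da z hz bz; exists [ffun s : {set X} => (a \in s) && z (s :\ a)].
  move=> s; rewrite ffunE => /andP[as_ /hz[Ds cs]].
  by rewrite (cardsD1 a) as_ cs -{1}(setD1K as_); split => //; apply: Da.
apply/ffunP => s; rewrite ffunE.
under eq_bigr => x _ do rewrite ffunE.
case: (boolP (a \in s)) => as_; last first.
  rewrite (bigD1 a) //= setU11 /= setU1K // big1 ?addr0 // => x /andP[_ xa].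
  by rewrite !inE eq_sym (negPf xa) (negPf as_).
have := congr1 (fun w : chain X => w (s :\ a)) bz.
rewrite !ffunE (bigD1 a) /=; last by rewrite !inE eqxx.
rewrite setD1K // => h.
transitivity (\sum_(x | (x \notin s :\ a) && (x != a)) z (x |: s :\ a)).
  apply: eq_big => [x|x xs].
    by rewrite !inE; case: eqVneq => [->|]; rewrite ?as_ ?andbT.
  rewrite setU1r //=; congr (z _); rewrite setDUl; congr (_ :|: _).
  by apply/setDidPl; rewrite disjoints1 inE; apply: contraNneq xs => ->.
by move: h; case: (z s); case: (\sum_(_ | _) _).
Qed.

(** Mayer-Vietoris.  In degree 0 the only nonzero cycle is the empty simplex,
    which already bounds in D1; hence there is no condition on D12 then. *)
Lemma acyclic_union (X : finType) (D D1 D2 D12 : pred {set X}) n :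
  down_closed D1 -> down_closed D2 -> D1 set0 ->
  (forall s, D s = D1 s || D2 s) -> (forall s, D12 s = D1 s && D2 s) ->
  acyclic_at D1 n -> acyclic_at D2 n ->
  (if n is m.+1 then acyclic_at D12 m else True) ->
  acyclic_at D n.
Proof.
move=> dc1 dc2 D10 DE D12E ac1 ac2 ac12 z hz bz.
(* Cut z into a part in D1 and a part in D2: their common boundary is a cycle of
   D12, and a chain y bounding it there turns both parts into cycles. *)
case: n => [|n] in ac1 ac2 ac12 hz *.
  have [s /hz[_ c0]|y hy <-] := ac1 z _ bz.
    by split=> //; move/eqP: c0; rewrite cards_eq0 => /eqP->.
  by exists y => // s /hy[D1s cs]; rewrite DE D1s.
pose z1 : chain X := [ffun s : {set X} => z s && D1 s].
pose z2 : chain X := [ffun s : {set X} => z s && ~~ D1 s].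
have zE : z = z1 + z2.
  by apply/ffunP => s; rewrite !ffunE; case: (z s) (D1 s) => [] [].
have h1 : supported D1 n.+1 z1 by move=> s; rewrite ffunE => /andP[/hz[_ ?]].
have h2 : supported D2 n.+1 z2.
  move=> s; rewrite ffunE => /andP[/hz[]]; rewrite DE => /orP[->//|->] ?.
  by [].
have b12 : bd z1 = bd z2 by apply: addr_eq0_chain; rewrite -bdD -zE.
have hw : supported D12 n (bd z1).
  move=> s ws; rewrite D12E.
  have [-> cs] := supported_bd dc1 h1 ws.
  by rewrite b12 in ws; have [-> _] := supported_bd dc2 h2 ws.
have [y hy by_] := ac12 _ hw (bd_bd _).
have hy1 : supported D1 n.+1 y by move=> s /hy[]; rewrite D12E => /andP[].
have hy2 : supported D2 n.+1 y by move=> s /hy[]; rewrite D12E => /andP[].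
have [|x1 hx1 bx1] := ac1 (z1 + y) (supportedD h1 hy1).
  by rewrite bdD by_ chain_addrr.
have [|x2 hx2 bx2] := ac2 (z2 + y) (supportedD h2 hy2).
  by rewrite bdD by_ b12 chain_addrr.
exists (x1 + x2); last first.
  by rewrite bdD bx1 bx2 addrACA chain_addrr addr0 zE.
by apply: supportedD => s => [/hx1|/hx2] []; rewrite DE => ->; rewrite ?orbT.
Qed.

(** Chain maps and homotopies are built one simplex at a time: the value at s is
    constrained only through the values at the facets of s. *)
Lemma face_recursion (X Y : finType) (S : pred {set X})
    (Q : {set X} -> chain Y -> chain Y -> Prop) :
  (forall F s, S s -> (forall x, x \in s -> Q (s :\ x) (pull F (s :\ x)) (F (s :\ x))) ->
     exists y, Q s (pull F s) y) ->
  down_closed S ->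
  exists F, forall s, S s -> Q s (pull F s) (F s).
Proof.
move=> step dS.
suff [F hF] : exists F, forall s, S s -> (#|s| < #|X|.+1)%N -> Q s (pull F s) (F s).
  by exists F => s Ss; apply: hF => //; rewrite ltnS max_card.
elim: (#|X|.+1) => [|n [F hF]]; first by exists (fun=> 0).
have [y hy] : exists y : {set X} -> chain Y,
    forall s, S s && (#|s| == n) -> Q s (pull F s) (y s).
  apply: (fin_all_exists (U := fun=> chain Y) (P := fun s y => S s && (#|s| == n) -> Q s (pull F s) y)) => s.
  case: (boolP (S s && (#|s| == n))) => [/andP[Ss /eqP cs]|]; last by exists 0.
  have [|y hy] := step F s Ss; last by exists y.
  move=> x xs; apply: hF; first by apply: dS Ss; apply: subsetDl.
  by move: cs; rewrite (cardsD1 x) xs => <-.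
pose F' (s : {set X}) := if #|s| == n then y s else F s.
have pullE (s : {set X}) : (#|s| <= n)%N -> pull F' s = pull F s.
  move=> cs; apply: eq_bigr => x xs; rewrite /F' ifN //.
  by rewrite neq_ltn; move: cs; rewrite (cardsD1 x) xs => ->.
exists F' => s Ss; rewrite ltnS => cs; rewrite pullE // /F'.
case: ifPn => [cn|cn]; first by apply: hy; rewrite Ss cn.
by apply: hF => //; rewrite ltn_neqAle cn.
Qed.

(** Acyclic carriers: the value at s fills the cycle pull F s inside C s. *)
Lemma acyclic_carrier (X Y : finType) (S : pred {set X}) (C : {set X} -> pred {set Y}) :
  down_closed S -> C set0 set0 ->
  (forall s x, S s -> x \in s -> subpred (C (s :\ x)) (C s)) ->
  (forall s, S s -> s != set0 -> acyclic_at (C s) #|s|.-1) ->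
  exists F, [/\ F set0 = pt Y, forall s, S s -> supported (C s) #|s| (F s)
    & forall s, S s -> bd (F s) = pull F s].
Proof.
move=> dS C0 monC acC.
pose Q s (w y : chain Y) :=
  [/\ s = set0 -> y = pt Y, supported (C s) #|s| y & bd y = w].
have [||F hF] := @face_recursion X Y S Q => //.
  move=> F s Ss hF; have [s0|s0] := eqVneq s set0.
    exists (pt Y); rewrite /Q s0 bd_pt /pull big_set0 cards0.
    by split=> //; apply: supported_pt.
  have [|| y hy by_] := acC s Ss s0 (pull F s).
  - apply: supported_sum => x xs t ht.
    have [_ hs _] := hF x xs; have [Ct ct] := hs t ht.
    by rewrite (monC s x) // (cardsD1 x) xs.
  - rewrite bd_sum -[RHS](pull_pull F s); apply: eq_bigr => x xs.
    by have [] := hF x xs.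
  exists y; split=> //; first by move/eqP; rewrite (negPf s0).
  by move: hy; rewrite prednK // card_gt0.
have [emp|nemp] := boolP (S set0); last first.
  have Sn s : S s = false.
    by apply/negP => /(dS _ _ (sub0set s)); rewrite (negPf nemp).
  by exists (fun=> pt Y); split=> // s; rewrite Sn.
exists F; split; first by have [->] := hF _ emp.
  by move=> s /hF[].
by move=> s /hF[].
Qed.

(** A chain map G from an acyclic complex to itself is null-homotopic, say
    G = bd H + H bd.  Both terms have the same trace, since tr(ab) = tr(ba), and
    so the trace of G is zero modulo 2. *)
Lemma trace_acyclic_eq0 (X : finType) (S : pred {set X}) (G : {set X} -> chain X) :
  down_closed S -> (forall n, acyclic_at S n) ->
  (forall s, S s -> supported S #|s| (G s)) ->
  (forall s, S s -> bd (G s) = pull G s) ->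
  \sum_(s | S s) G s s = 0.
Proof.
move=> dS acS hG bG.
pose Q (s : {set X}) w y := supported S #|s|.+1 y /\ bd y = G s + w.
have [|//|H hH] := @face_recursion X X S Q.
  move=> F s Ss hF.
  have [||y hy by_] := acS #|s| (G s + pull F s); last by exists y.
    apply: supportedD; first exact: hG.
    apply: supported_sum => x xs t; have [h _] := hF x xs.
    by move/h; rewrite (cardsD1 x s) xs.
  rewrite bdD bG // {2}/pull bd_sum.
  have -> : \sum_(x in s) bd (F (s :\ x)) = pull G s + pull (pull F) s.
    rewrite -big_split /=; apply: eq_bigr => x xs.
    by have [_] := hF x xs.
  by rewrite pull_pull addr0 chain_addrr.
have GE s : S s -> G s s = bd (H s) s + pull H s s.
  move=> Ss; have [_ ->] := hH s Ss.
  by rewrite ffunE -addrA [X in _ + X]addbb addr0.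
rewrite (eq_bigr _ GE) big_split /=.
suff -> : \sum_(s | S s) bd (H s) s = \sum_(s | S s) pull H s s by exact: addbb.
transitivity (\sum_(s : {set X}) \sum_(x | x \notin s) (S (x |: s) && H s (x |: s))).
  rewrite big_mkcond; apply: eq_bigr => s _; case: ifP => Ss.
    rewrite ffunE; apply: eq_bigr => x xs.
    case: (boolP (H s _)) => [hx|]; last by rewrite andbF.
    by have [/(_ _ hx)[-> _]] := hH s Ss.
  rewrite big1 // => x _; case: (boolP (S _)) => // /(dS _ _ (subsetUr _ _)).
  by rewrite Ss.
rewrite -(sum_faces (fun _ t s => S s && H t s)) [RHS]big_mkcond.
apply: eq_bigr => s _; case: ifP => Ss; last by rewrite big1.
by rewrite /pull sum_chainE.
Qed.

End Chains.

(** * The complex of partial transversals *)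

Section Transversals.
Variables (E I : finType) (U : I -> {set E}).
Implicit Types S t : {set E}.
Hypothesis U_disj : forall i j, i != j -> [disjoint U i & U j].

Definition partial_transversal (S t : {set E}) :=
  (t \subset S) && [forall i, #|t :&: U i| <= 1].

Definition colours (S : {set E}) := [set i | S :&: U i != set0].

Lemma down_closed_partial_transversal S : down_closed (partial_transversal S).
Proof.
move=> s t st /andP[tS /forallP h]; rewrite /partial_transversal (subset_trans st) //.
by apply/forallP => i; apply: leq_trans (h i); apply/subset_leq_card/setSI.
Qed.

Lemma colour_inj i j u : u \in U i -> u \in U j -> i = j.
Proof.
move=> ui uj; apply/eqP; apply: contraTT ui => ij.
by rewrite (disjointFl (U_disj ij)).
Qed.

(** If S contains a single element u of some class, that element is a cone
    point.  Otherwise pick u in a class U i with at least two elements in S, and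
    cover the complex by the partial transversals avoiding u and those using no
    element of U i other than u; they meet in the partial transversals avoiding
    U i altogether, for which one class is lost. *)
Lemma acyclic_partial_transversal S n :
  n < #|colours S| -> acyclic_at (partial_transversal S) n.
Proof.
have [m] := ubnP #|S|; elim: m S n => // m IH S n; rewrite ltnS => Sm nc.
have /card_gt0P[i iC] := leq_ltn_trans (leq0n n) nc.
have /set0Pn[u] : S :&: U i != set0 by rewrite inE in iC.
rewrite inE => /andP[uS uUi].
have [Su|Su] := boolP (S :&: U i \subset [set u]).
  apply: (@acyclic_cone _ _ u) => t /andP[tS /forallP ht].
  rewrite /partial_transversal subUset sub1set uS tS /=; apply/forallP => j.
  have [<-|ij] := eqVneq i j.
    rewrite -(cards1 u); apply/subset_leq_card/(subset_trans _ Su)/setSI.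
    by rewrite subUset sub1set uS.
  rewrite setIUl (_ : [set u] :&: U j = set0) ?set0U //.
  apply/setP => x; rewrite !inE; case: eqP => //= ->.
  by rewrite (disjointFr (U_disj ij)).
have /subsetPn[w] := Su; rewrite !inE => /andP[wS wUi] wu.
have cu : colours (S :\ u) = colours S.
  apply/setP => j; rewrite !inE; apply/set0Pn/set0Pn => -[x]; rewrite !inE.
    by case/andP=> /andP[_ xS] xj; exists x; rewrite !inE xS.
  case/andP=> xS xj; have [xu|xu] := eqVneq x u; last first.
    by exists x; rewrite !inE xu xS.
  by exists w; rewrite !inE wu wS (@colour_inj j i u) // -xu.
have cd : #|colours S| = #|colours (S :\: U i)|.+1.
  rewrite (cardsD1 i) iC; congr (_.+1); apply: eq_card => j; rewrite !inE.
  have [->|ij] := eqVneq j i; first by rewrite setIDAC setDIl setDv !setI0 eqxx.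
  rewrite setIDAC; congr (_ != _); apply/esym/setDidPl.
  by apply: disjointWl (U_disj ij); apply: subsetIr.
have cU : #|colours S| <= #|colours (u |: (S :\: U i))|.
  apply/subset_leq_card/subsetP => j; rewrite !inE => /set0Pn[x].
  rewrite !inE => /andP[xS xj]; apply/set0Pn.
  have [ij|ij] := eqVneq j i; first by exists u; rewrite !inE eqxx ij.
  by exists x; rewrite !inE xS xj (disjointFr (U_disj ij)) // orbT.
have lt1 : #|S :\ u| < m by apply: leq_trans Sm; rewrite [X in _ < X](cardsD1 u) uS.
have sub2 : u |: (S :\: U i) \subset S :\ w.
  apply/subsetP => x; rewrite !inE => /orP[/eqP->|/andP[xi ->]].
    by rewrite eq_sym wu.
  by rewrite andbT; apply: contraNneq xi => ->.
have lt2 : #|u |: (S :\: U i)| < m.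
  apply: leq_ltn_trans (subset_leq_card sub2) _.
  by apply: leq_trans Sm; rewrite [X in _ < X](cardsD1 w) wS.
have lt3 : #|S :\: U i| < m.
  by apply: leq_ltn_trans lt2; apply/subset_leq_card/subsetUr.
apply: (acyclic_union (D1 := partial_transversal (S :\ u))
  (D2 := partial_transversal (u |: (S :\: U i)))
  (D12 := partial_transversal (S :\: U i))).
- exact: down_closed_partial_transversal.
- exact: down_closed_partial_transversal.
- rewrite /partial_transversal sub0set; apply/forallP => j.
  by rewrite set0I cards0.
- move=> t; rewrite /partial_transversal -andb_orl.
  case: (boolP [forall i, _]) => [/forallP/(_ i) ht|]; last by rewrite !andbF.
  rewrite !andbT; apply/idP/orP => [tS|[h|h]].
  + have [ut|ut] := boolP (u \in t); [right|left]; last by rewrite subsetD1 tS.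
    apply/subsetP => x xt; rewrite !inE (subsetP tS) // andbT.
    case: eqP => //= xu; apply/negP => xi; apply: xu.
    by move/card_le1_eqP: ht; apply; rewrite inE ?xt ?ut.
  + exact: subset_trans h (subsetDl _ _).
  + by apply: subset_trans h _; rewrite subUset sub1set uS subsetDl.
- move=> t; rewrite /partial_transversal andbACA andbb -subsetI.
  suff -> : (S :\ u) :&: (u |: (S :\: U i)) = S :\: U i by [].
  apply/setP => x; rewrite !inE.
  have [->|_] := eqVneq x u; first by rewrite uUi.
  by case: (x \in S); rewrite ?andbF ?andbT.
- by apply: IH lt1 _; rewrite cu.
- by apply: IH lt2 _; apply: leq_trans cU.
- by case: n nc => // n nc; apply: IH lt3 _; rewrite -ltnS -cd.
Qed.

End Transversals.

(** * Regions of an oriented matroid and their order complexes *)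

Section Regions.
Variables (E : finType) (O : oriented_matroid E) (v0 : E).
Implicit Types (N P t S : {set E}) (f g : signvec E) (A s : {set signvec E}).

(** The affine part f v0 = + of the arrangement, cut by weak sign conditions:
    nonpositive on N, nonnegative on P. *)
Definition region (N P : {set E}) : {set signvec E} :=
  [set f in covectors O | [&& f v0 == Pos,
     [forall v in N, f v != Pos] & [forall v in P, f v != Neg]]].

Definition sv_le (f g : signvec E) := [forall e, sign_le (f e) (g e)].

(** Simplices of the order complex of A. *)
Definition flag (A s : {set signvec E}) :=
  (s \subset A) && [forall f in s, forall g in s, sv_le f g || sv_le g f].

Lemma regionP N P f :
  reflect [/\ f \in covectors O, f v0 = Pos, {in N, forall v, f v != Pos}
             & {in P, forall v, f v != Neg}]
          (f \in region N P).
Proof.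
rewrite inE; apply: (iffP and4P) => -[fO f0 fN fP]; split=> //.
- exact/eqP.
- by move=> v vN; apply: (implyP (forallP fN v)).
- by move=> v vP; apply: (implyP (forallP fP v)).
- exact/eqP.
- exact/forall_inP.
- exact/forall_inP.
Qed.

Lemma down_closed_flag A : down_closed (flag A).
Proof.
move=> s t st /andP[tA /forall_inP h]; rewrite /flag (subset_trans st) //.
apply/forall_inP => f fs; apply/forall_inP => g gs.
by apply: (forall_inP (h f _)); apply: (subsetP st).
Qed.

Lemma flag0 A : flag A set0.
Proof. by rewrite /flag sub0set; apply/forall_inP => f; rewrite inE. Qed.

Lemma flagI A B s : flag (A :&: B) s = flag A s && flag B s.
Proof. by rewrite /flag subsetI andbACA andbb. Qed.

Lemma regionU1l N P u : region (u |: N) P = region N P :&: region [set u] set0.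
Proof.
apply/setP => f; rewrite in_setI; apply/regionP/andP.
  case=> fO f0 fN fP; split; apply/regionP; split=> // v; rewrite ?inE // => vN.
    by apply: fN; rewrite in_setU1 vN orbT.
  by apply: fN; rewrite in_setU1 vN.
case=> /regionP[fO f0 fN fP] /regionP[_ _ fu _]; split=> // v.
by rewrite in_setU => /orP[/fu|/fN].
Qed.

Lemma regionU1r N P u : region N (u |: P) = region N P :&: region set0 [set u].
Proof.
apply/setP => f; rewrite in_setI; apply/regionP/andP.
  case=> fO f0 fN fP; split; apply/regionP; split=> // v; rewrite ?inE // => vN.
    by apply: fP; rewrite in_setU1 vN orbT.
  by apply: fP; rewrite in_setU1 vN.
case=> /regionP[fO f0 fN fP] /regionP[_ _ _ fu]; split=> // v.
by rewrite in_setU => /orP[/fu|/fP].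
Qed.

Lemma region_comp N P f g :
  f \in region N P -> g \in region N P -> sv_comp f g \in region N P.
Proof.
case/regionP=> fO f0 fN fP /regionP[gO g0 gN gP]; apply/regionP; split.
- exact: covector_comp.
- by rewrite ffunE f0.
- by move=> v vN; rewrite ffunE; case: ifP => _; [apply: fN|apply: gN].
- by move=> v vP; rewrite ffunE; case: ifP => _; [apply: fP|apply: gP].
Qed.

(** Regions are convex: eliminating e never leaves a region, because two of its
    covectors are not separated by an element of N, P or v0. *)
Lemma region_elim N P f g e :
  f \in region N P -> g \in region N P -> f e = Pos -> g e = Neg ->
  exists2 h, h \in region N P & h e = Zero.
Proof.
case/regionP=> fO f0 fN fP /regionP[gO g0 gN gP] fe ge.
have [|h hO [he hE]] := covector_elim fO gO (v := e).
  by rewrite !inE fe ge.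
exists h => //; apply/regionP; split=> //.
- by rewrite hE ?ffunE ?f0 // !inE f0 g0.
- move=> v vN; have := fN v vN; have := gN v vN => gv fv.
  rewrite hE ?ffunE; first by case: ifP.
  by rewrite !inE (negPf fv) (negPf gv) andbF.
- move=> v vP; have := fP v vP; have := gP v vP => gv fv.
  rewrite hE ?ffunE; first by case: ifP.
  by rewrite !inE (negPf fv) (negPf gv) andbF.
Qed.

(** Induction on the number of elements without a prescribed sign.  A flag
    cannot contain covectors of opposite signs at e, as these are incomparable;
    so the order complex is the union of those of the two half-regions at e. *)
Lemma acyclic_region N P n :
  region N P != set0 -> acyclic_at (flag (region N P)) n.
Proof.
have [m] := ubnP #|~: (N :|: P)|.
elim: m N P n => // m IH N P n; rewrite ltnS => cm R0.
have [NP|] := eqVneq (~: (N :|: P)) set0.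
  (* All signs are prescribed, so the region has a greatest element: a covector
     T of maximal support, since T o f has the same support as T. *)
  have [f0 Rf0] := set0Pn _ R0.
  have [T RT Tmax] := arg_maxnP (fun f : signvec E => #|[set e | f e != Zero]|) Rf0.
  have {}RT : T \in region N P := RT.
  have leT f : f \in region N P -> sv_le f T.
    move=> Rf; have /setP TfT : [set e | sv_comp T f e != Zero] = [set e | T e != Zero].
      apply/esym/eqP; rewrite eqEcard.
      rewrite (_ : (_ <= _)%N); last by apply: Tmax; apply: region_comp.
      rewrite andbT.
      apply/subsetP => e; rewrite !inE ffunE => Te.
      by rewrite Te.
    apply/forallP => e; rewrite /sign_le.
    have : e \in N :|: P by move/setP/(_ e): NP; rewrite !inE => /negbFE.
    have := TfT e; rewrite !inE ffunE.
    case/regionP: Rf => _ _ fN fP; case/regionP: RT => _ _ TN TP.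
    move=> + /orP[eN|eP].
      by move: (fN e eN) (TN e eN); case: (f e) (T e) => [] [].
    by move: (fP e eP) (TP e eP); case: (f e) (T e) => [] [].
  apply: (@acyclic_cone _ _ T) => s /andP[sR /forall_inP hs].
  rewrite /flag subUset sub1set RT sR /=.
  apply/forall_inP => f; rewrite in_setU1 => fs.
  apply/forall_inP => g; rewrite in_setU1 => gs.
  have Rs h : h \in s -> h \in region N P by apply: (subsetP sR).
  case/orP: fs => [/eqP->|fs].
    by case/orP: gs => [/eqP->|/Rs/leT ->]; rewrite ?leT ?orbT.
  by case/orP: gs => [/eqP->|gs]; [rewrite leT ?Rs | apply: (forall_inP (hs f fs))].
case/set0Pn=> e; rewrite in_setC => eNP.
have smaller N' P' : N' :|: P' = e |: (N :|: P) -> #|~: (N' :|: P')| < m.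
  move=> ->; apply: leq_trans cm; rewrite [X in _ < X](cardsD1 e) inE eNP.
  by rewrite ltnS; apply/subset_leq_card/subsetP => x; rewrite !inE negb_or.
have smN : #|~: ((e |: N) :|: P)| < m by apply: smaller; rewrite setUA.
have smP : #|~: (N :|: (e |: P))| < m by apply: smaller; rewrite setUCA.
have smNP : #|~: ((e |: N) :|: (e |: P))| < m.
  by apply: smaller; rewrite setUACA setUid.
(* If e does not take both signs on the region, a condition at e is free. *)
have [/exists_inP[g Rg /eqP ge]|noneg] :=
    boolP [exists g in region N P, g e == Neg]; last first.
  have -> : region N P = region N (e |: P).
    rewrite regionU1r; apply/esym/setIidPl/subsetP => f Rf.
    apply/regionP; case/regionP: (Rf) => fO f0 _ _; split=> // v; rewrite inE // => /eqP->.
    by apply: contra noneg => fe; apply/exists_inP; exists f.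
  apply: IH => //; have [f Rf] := set0Pn _ R0.
  apply/set0Pn; exists f; rewrite regionU1r in_setI Rf.
  apply/regionP; case/regionP: (Rf) => fO f0 _ _; split=> // v; rewrite inE // => /eqP->.
  by apply: contra noneg => fe; apply/exists_inP; exists f.
have [/exists_inP[f Rf /eqP fe]|nopos] :=
    boolP [exists f in region N P, f e == Pos]; last first.
  have RE : region N P = region (e |: N) P.
    rewrite regionU1l; apply/esym/setIidPl/subsetP => f Rf.
    apply/regionP; case/regionP: (Rf) => fO f0 _ _; split=> // v; rewrite inE // => /eqP->.
    by apply: contra nopos => fe; apply/exists_inP; exists f.
  by rewrite RE; apply: IH => //; rewrite -RE.
have [h Rh he] := region_elim Rf Rg fe ge.
have inN k : k \in region N P -> k e != Pos -> k \in region (e |: N) P.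
  move=> Rk ke; rewrite regionU1l in_setI Rk; case/regionP: Rk => kO k0 _ _.
  by apply/regionP; split=> // v; rewrite inE // => /eqP->.
have inP k : k \in region N P -> k e != Neg -> k \in region N (e |: P).
  move=> Rk ke; rewrite regionU1r in_setI Rk; case/regionP: Rk => kO k0 _ _.
  by apply/regionP; split=> // v; rewrite inE // => /eqP->.
apply: (acyclic_union (D1 := flag (region (e |: N) P))
  (D2 := flag (region N (e |: P))) (D12 := flag (region (e |: N) (e |: P)))).
- exact: down_closed_flag.
- exact: down_closed_flag.
- exact: flag0.
- move=> s; rewrite /flag -andb_orl.
  case: (boolP [forall f in s, _]) => [/forall_inP hs|]; last by rewrite !andbF.
  rewrite !andbT; apply/idP/orP => [sR|[]]; last 2 first.
  + by move/subset_trans; apply; rewrite regionU1l subsetIl.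
  + by move/subset_trans; apply; rewrite regionU1r subsetIl.
  have [/exists_inP[p ps /eqP pe]|nop] := boolP [exists p in s, p e == Pos].
    right; apply/subsetP => k ks; apply: inP; first exact: (subsetP sR).
    have /orP[] := forall_inP (hs p ps) k ks => /forallP/(_ e); rewrite /sign_le pe.
      by move/eqP <-.
    by case/orP=> /eqP->.
  left; apply/subsetP => k ks; apply: inN; first exact: (subsetP sR).
  by apply: contra nop => ke; apply/exists_inP; exists k.
- move=> s; rewrite -flagI; congr (flag _ s).
  by rewrite !regionU1l !regionU1r setIACA setIid setIAC setIA.
- by apply: IH => //; apply/set0Pn; exists g; apply: inN; rewrite ?ge.
- by apply: IH => //; apply/set0Pn; exists f; apply: inP; rewrite ?fe.
- case: n => // n; apply: IH => //; apply/set0Pn; exists h.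
  rewrite regionU1r in_setI inN ?he //; case/regionP: Rh => hO h0 _ _.
  by apply/regionP; split=> // v; rewrite inE // => /eqP->; rewrite he.
Qed.

(** Simplices of the union, over u in t, of the order complexes of the regions
    nonpositive on N and u. *)
Definition union_flag N t s :=
  flag (region N set0) s && ((s == set0) || [exists u in t, s \subset region [set u] set0]).

Lemma down_closed_union_flag N t : down_closed (union_flag N t).
Proof.
move=> s s' ss' /andP[fs' h]; rewrite /union_flag (down_closed_flag ss') //=.
case/orP: h => [/eqP s0|/exists_inP[u ut us]].
  by move: ss'; rewrite s0 subset0 => ->.
by apply/orP; right; apply/exists_inP; exists u => //; apply: subset_trans us.
Qed.

Lemma flag_union_flag N u s :
  flag (region (u |: N) set0) s =
  flag (region N set0) s && (s \subset region [set u] set0).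
Proof. by rewrite /flag regionU1l subsetI andbAC. Qed.

(** The nerve lemma for regions having a common point: adding the regions one
    at a time, the new one meets the union of the others in a union of the same
    kind, with u moved to N. *)
Lemma acyclic_union_flag N t n :
  t != set0 -> region (t :|: N) set0 != set0 ->
  acyclic_at (union_flag N t) n.
Proof.
have [m] := ubnP #|t|; elim: m N t n => // m IH N t n; rewrite ltnS => tm t0 R0.
have [u ut] := set0Pn _ t0.
have ne (M : {set E}) : M \subset t :|: N -> region M set0 != set0.
  move=> sub; have [f /regionP[fO f0 fN fP]] := set0Pn _ R0.
  by apply/set0Pn; exists f; apply/regionP; split=> // v /(subsetP sub)/fN.
have neu : region (u |: N) set0 != set0.
  by apply: ne; apply: setSU; rewrite sub1set.
have [tu|tu] := eqVneq (t :\ u) set0.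
  apply: (@eq_acyclic_at _ (flag (region (u |: N) set0))); last exact: acyclic_region.
  move=> s; rewrite flag_union_flag /union_flag; congr (_ && _).
  rewrite -(setD1K ut) tu setU0; apply/idP/orP => [h|[/eqP->|/exists_inP[w]]].
  - by right; apply/exists_inP; exists u; rewrite ?inE.
  - exact: sub0set.
  - by rewrite inE => /eqP->.
have tum : #|t :\ u| < m by apply: leq_trans tm; rewrite [X in _ < X](cardsD1 u) ut.
apply: (acyclic_union (D1 := union_flag N (t :\ u))
  (D2 := flag (region (u |: N) set0)) (D12 := union_flag (u |: N) (t :\ u))).
- exact: down_closed_union_flag.
- exact: down_closed_flag.
- by rewrite /union_flag flag0 eqxx.
- move=> s; rewrite flag_union_flag /union_flag -andb_orr; congr (_ && _).
  apply/orP/orP => [[->|/exists_inP[w wt sw]]|[/orP[->|/exists_inP[w wt sw]]|us]].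
  + by left.
  + have [<-|wu] := eqVneq w u; [by right|left].
    by apply/orP; right; apply/exists_inP; exists w => //; rewrite !inE wu.
  + by left.
  + by right; apply/exists_inP; exists w => //; move: wt; rewrite inE => /andP[].
  + by right; apply/exists_inP; exists u.
- by move=> s; rewrite /union_flag flag_union_flag [RHS]andbACA andbb andbAC andbA.
- by apply: IH => //; apply: ne; apply: setSU; apply: subsetDl.
- exact: acyclic_region.
- by case: n => // n; apply: IH => //; rewrite setUCA setUA setD1K.
Qed.

(** A flag, ordered by size of support, is a chain of nonzero covectors; they are
    nonzero because they are positive at v0. *)
Lemma card_flag s : flag (region set0 set0) s -> #|s| <= om_rank O.
Proof.
case/andP=> /subsetP sR /forall_inP hs.
rewrite /om_rank; case: ex_maxnP => k _; apply.
pose wt (f : signvec E) := #|[set e | f e != Zero]|.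
pose r := sort (relpre wt leq) (enum s).
have szr : size r == #|s| by rewrite size_sort -cardE.
have mem_r : r =i s by move=> f; rewrite mem_sort mem_enum.
apply/existsP; exists (Tuple szr) => /=; apply/andP; split; last first.
  by apply/allP => f; rewrite mem_r => /sR/regionP[].
have wt_lt f g : f \in s -> g \in s -> f != g -> wt f <= wt g -> sv_lt f g.
  move=> fs gs fg w; rewrite /sv_lt fg /=.
  have /orP[//|gf] := forall_inP (hs f fs) g gs.
  have sub : [set e | g e != Zero] \subset [set e | f e != Zero].
    apply/subsetP => e; rewrite !inE; have := forallP gf e.
    by rewrite /sign_le; case: (g e) (f e) => [] [].
  have /setP eqs : [set e | g e != Zero] = [set e | f e != Zero].
    by apply/eqP; rewrite eqEcard sub.
  case/eqP: fg; apply/ffunP => e; have := forallP gf e; have := eqs e.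
  by rewrite !inE /sign_le; case: (g e) (f e) => [] [].
rewrite (path_pairwise (@sv_lt_trans E)) /=; apply/andP; split.
  apply/allP => f; rewrite mem_r => /sR/regionP[_ f0 _ _].
  rewrite /sv_lt; apply/andP; split.
    by apply/eqP => /ffunP/(_ v0); rewrite ffunE f0.
  by apply/forallP => e; rewrite ffunE.
have : pairwise (relpre wt leq) r.
  rewrite -sorted_pairwise; last by move=> ? ? ? /=; apply: leq_trans.
  by apply: sort_sorted => f g /=; apply: leq_total.
have : uniq r by rewrite sort_uniq enum_uniq.
have : {subset r <= s} by move=> f; rewrite mem_r.
elim: r {szr mem_r} => //= f r IHr rs /andP[fr ur] /andP[fle rle].
rewrite IHr // ?andbT; last by move=> g gr; apply: rs; rewrite inE gr orbT.
apply/allP => g gr; apply: wt_lt; rewrite ?rs ?inE ?eqxx ?gr ?orbT //.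
  by apply: contraNneq fr => ->.
exact: (allP fle).
Qed.

(** The easy half of Farkas' lemma: the vector that puts v0 in the hull of S is
    opposite to f at v0, hence agrees with f somewhere, and this must be on S. *)
Lemma conv_cut S f :
  v0 \notin S -> v0 \in conv O S -> f \in region set0 set0 ->
  exists2 u, u \in S & f u = Pos.
Proof.
move=> v0S + /regionP[fO f0 _ _].
rewrite !inE (negPf v0S) /= => /exists_inP[Phi].
rewrite inE => /forall_inP hPhi /andP[/subsetP PhiP /eqP PhiN].
have Phi0 : Phi v0 = Neg by apply/eqP; have := set11 v0; rewrite -PhiN inE.
have /eqP orth := hPhi f fO.
have : [exists w, (Phi w == sign_opp (f w)) && (sign_opp (f w) != Zero)].
  by apply/existsP; exists v0; rewrite Phi0 f0.
rewrite -orth => /existsP[v /andP[/eqP Phiv fv]].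
have v_ne : v != v0 by apply/eqP => vv0; move: Phiv; rewrite vv0 Phi0 f0.
exists v.
  apply: PhiP; rewrite inE; case Ev: (Phi v) => //.
    by move/setP/(_ v): PhiN; rewrite !inE Ev (negPf v_ne).
  by move: fv; rewrite -Phiv Ev.
case Ev : (f v) fv => //; move/setP/(_ v): PhiN.
by rewrite !inE Phiv Ev (negPf v_ne).
Qed.

(** The other half of Farkas' lemma.  Take M minimal in S with no covector
    positive at v0 and nonpositive on M; the vector is + on M and - at v0.  It
    is orthogonal to every g: this is clear if g v0 is nonzero; if g v0 = 0 and
    g had only one sign on M, eliminating u in M between g or -g and a covector f
    that shows the minimality of M at u would contradict the choice of M. *)
Lemma conv_of_cuts S :
  v0 \notin S -> region S set0 = set0 -> v0 \in conv O S.
Proof.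
move=> v0S R0.
have [M /minsetP[/eqP RM minM] MS] := minset_exists (P := fun M => region M set0 == set0) (introT eqP R0).
have v0M : v0 \notin M by apply: contra v0S; apply: (subsetP MS).
rewrite !inE (negPf v0S) /=; apply/exists_inP.
pose Phi : signvec E := [ffun e => if e == v0 then Neg else if e \in M then Pos else Zero].
have PhiE e : Phi e = if e == v0 then Neg else if e \in M then Pos else Zero.
  by rewrite ffunE.
exists Phi; last first.
  apply/andP; split.
    apply/subsetP => e; rewrite inE PhiE; case: ifP => // _.
    by case: ifP => // /(subsetP MS).
  apply/eqP/setP => e; rewrite !inE PhiE.
  by case: (e == v0); case: (e \in M).
have cut g : g \in covectors O -> g v0 = Pos -> exists2 u, u \in M & g u = Pos.
  move=> gO g0; have [/exists_inP[u uM /eqP gu]|noM] := boolP [exists u in M, g u == Pos].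
    by exists u.
  suff : g \in region M set0 by rewrite RM inE.
  apply/regionP; split=> // v; rewrite ?inE // => vM.
  by apply: contra noM => gv; apply/exists_inP; exists v.
have flat g u : g \in covectors O -> g v0 = Zero -> u \in M -> g u = Pos ->
    exists2 w, w \in M & g w = Neg.
  move=> gO g0 uM gu; have [/exists_inP[w wM /eqP gw]|noM] := boolP [exists w in M, g w == Neg].
    by exists w.
  have /set0Pn[f /regionP[fO f0 fM _]] : region (M :\ u) set0 != set0.
    apply/eqP => Ru; have := minM (M :\ u); rewrite Ru eqxx => /(_ isT (subsetDl _ _)) Mu.
    by move: uM; rewrite -Mu !inE eqxx.
  have fu : f u = Pos.
    have [w wM fw] := cut f fO f0; have [<- //|wu] := eqVneq w u.
    by have := fM w; rewrite !inE wu wM fw => /(_ isT).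
  have hO : sv_opp g \in covectors O by apply/covector_opp.
  have [|h hO' [hu hE]] := covector_elim fO hO (v := u).
    by rewrite !inE ffunE fu gu.
  have h0 : h v0 = Pos by rewrite hE ?ffunE ?f0 // !inE ffunE f0 g0.
  have [w wM hw] := cut h hO' h0.
  have wu : w != u by apply: contra_eq_neq hw => ->; rewrite hu.
  have fw : f w != Pos by apply: fM; rewrite !inE wu.
  have gw : g w != Neg by apply: contra noM => gw; apply/exists_inP; exists w.
  move: hw; rewrite hE; last first.
    by rewrite !inE ffunE (negPf fw) /=; case: (g w) gw; rewrite ?andbF.
  by rewrite !ffunE; case: (f w) (g w) fw gw => [] [].
have PhiM u : u \in M -> Phi u = Pos.
  by move=> uM; rewrite PhiE uM; case: eqP => // uv; rewrite -uv uM in v0M.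
have Phi0 : Phi v0 = Neg by rewrite PhiE eqxx.
rewrite inE; apply/forall_inP => g gO; rewrite /sv_orth.
have both v w : Phi v = g v -> Phi v != Zero -> Phi w = sign_opp (g w) -> Phi w != Zero ->
  [exists v, (Phi v == g v) && (g v != Zero)] ==
  [exists w, (Phi w == sign_opp (g w)) && (sign_opp (g w) != Zero)].
  move=> e1 z1 e2 z2.
  have -> : [exists v, (Phi v == g v) && (g v != Zero)].
    by apply/existsP; exists v; rewrite -e1 eqxx.
  have -> // : [exists w, (Phi w == sign_opp (g w)) && (sign_opp (g w) != Zero)].
  by apply/existsP; exists w; rewrite -e2 eqxx.
have hO : sv_opp g \in covectors O by apply/covector_opp.
case g0: (g v0).
- have [|u uM] := cut _ hO; first by rewrite ffunE g0.
  rewrite ffunE => gu; apply: (both v0 u); rewrite ?Phi0 ?PhiM ?g0 //.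
- have [/exists_inP[u uM gu]|noM] := boolP [exists u in M, g u != Zero].
    case gu': (g u) gu => // _.
      have [||w wM gw] := flat (sv_opp g) u hO _ uM; rewrite ?ffunE ?g0 ?gu' //.
      apply: (both w u); rewrite ?PhiM ?gu' //.
      by move: gw; rewrite ffunE; case: (g w).
    have [w wM gw] := flat g u gO g0 uM gu'.
    by apply: (both u w); rewrite ?PhiM ?gu' ?gw.
  have zero e : Phi e != Zero -> g e = Zero.
    rewrite PhiE; have [-> //|_] := eqVneq e v0; case: ifP => // eM _.
    by apply/eqP; apply: contraNT noM => ge; apply/exists_inP; exists e.
  apply/eqP; transitivity false; last apply/esym.
    apply/existsP => -[e /andP[/eqP h ge]].
    by move: (ge); rewrite zero ?h.
  apply/existsP => -[e /andP[/eqP h ge]].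
  by move: (ge); rewrite zero ?h.
- have [u uM gu] := cut _ gO g0.
  by apply: (both u v0); rewrite ?Phi0 ?PhiM ?g0 ?gu.
Qed.

End Regions.

(** * The colourful theorem *)

Theorem theorem1p10 (E : finType) (V : {set E}) (v0 : E)
    (v0_notin_V : v0 \notin V) (E_def : v0 |: V = [set: E])
    (d : nat) (O : oriented_matroid E) (rank_le : om_rank O <= d)
    (r : nat) (r_ge : d.+1 <= r) (U : 'I_r -> {set E})
    (U_sub : forall i, U i \subset V)
    (U_disj : forall i j, i != j -> [disjoint U i & U j])
    (U_nonempty : forall i, U i != set0)
    (v0_conv : v0 \in
       \bigcap_(i < r) \bigcap_(j < r | i < j) conv O (U i :|: U j)) :
  exists u : 'I_r -> E,
    (forall i, u i \in U i) /\ v0 \in conv O [set u i | i : 'I_r].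
Proof.
have v0U i : v0 \notin U i by apply: contra v0_notin_V; apply: (subsetP (U_sub i)).
pose W := \bigcup_i U i.
pose J := partial_transversal U W.
pose D := flag (region O v0 set0 set0).
(* No two classes can both lack a positive element at a covector f. *)
have pos_colours f : f \in region O v0 set0 set0 -> d <= #|colours U [set u in W | f u == Pos]|.
  move=> Rf; set C := colours _ _.
  have hit i u : u \in U i -> f u = Pos -> i \in C.
    move=> ui fu; rewrite inE; apply/set0Pn; exists u.
    by rewrite !inE fu eqxx ui !andbT; apply/bigcupP; exists i.
  have cC : #|~: C| <= 1.
    apply/card_le1_eqP => i j iC jC; apply/eqP; apply: contraT => ij.
    have key a b : a \in ~: C -> b \in ~: C -> a < b -> False.
      move=> aC bC ab; move/bigcapP: v0_conv => /(_ a isT)/bigcapP/(_ b ab) h.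
      have [|u] := conv_cut _ h Rf; first by rewrite in_setU negb_or !v0U.
      rewrite !inE => /orP[/hit h'|/hit h'] /h'; first by move: aC; rewrite inE => /negP.
      by move: bC; rewrite inE => /negP.
    have [ltij|ltji|/val_inj eij] := ltngtP i j.
    - by case: (key i j iC jC ltij).
    - by case: (key j i jC iC ltji).
    - by rewrite eij eqxx in ij.
  have : #|C| + #|~: C| <= #|C| + 1 by rewrite leq_add2l.
  by rewrite cardsC card_ord addn1; apply: leq_trans r_ge.
have [/existsP[u /andP[/forallP uU h]]|none] := boolP [exists u : {ffun 'I_r -> E},
   [forall i, u i \in U i] && (v0 \in conv O [set u i | i : 'I_r])].
  by exists u.
(* Extend t to a full transversal u; the default v0 is never reached. *)
have RJ t : J t -> region O v0 t set0 != set0.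
  case/andP=> /subsetP tW /forallP ht.
  pose u := [ffun i => if [pick x in t :&: U i] is Some x then x
               else if [pick x in U i] is Some x then x else v0].
  have uU i : u i \in U i.
    rewrite ffunE; case: pickP => [x|_]; first by rewrite inE => /andP[].
    by case: pickP => // h; case/set0Pn: (U_nonempty i) => x; rewrite h.
  have tu : t \subset [set u i | i : 'I_r].
    apply/subsetP => x xt; have /bigcupP[i _ xi] := tW x xt.
    apply/imsetP; exists i => //; rewrite ffunE; case: pickP => [y yt|/(_ x)].
      by move/card_le1_eqP: (ht i); apply=> //; rewrite inE xt.
    by rewrite inE xt xi.
  apply: contra none => /eqP R0; apply/existsP; exists u; apply/andP; split; first exact/forallP.
  apply: conv_of_cuts.
    by apply/imsetP => -[i _ v0i]; move: (v0U i); rewrite v0i uU.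
  apply/setP => f; rewrite in_set0; apply/negP => /regionP[fO f0 fN fP].
  suff : f \in region O v0 t set0 by rewrite R0 inE.
  by apply/regionP; split=> // v /(subsetP tu)/fN.
have dJ : down_closed J := @down_closed_partial_transversal _ _ _ _.
have J0 : J set0.
  by rewrite /J /partial_transversal sub0set; apply/forallP => i; rewrite set0I cards0.
have dD : down_closed D by apply: down_closed_flag.
have [Phi [Phi0 sPhi bPhi]] : exists F : {set E} -> {ffun {set signvec E} -> bool},
   [/\ F set0 = pt _, forall t, J t -> supported (union_flag O v0 set0 t) #|t| (F t)
    & forall t, J t -> bd (F t) = pull F t].
  apply: acyclic_carrier => //.
  - by rewrite /union_flag flag0 eqxx.
  - move=> t x Jt xt s /andP[Ds h]; rewrite /union_flag Ds /=.
    case/orP: h => [->//|/exists_inP[w wt ws]]; apply/orP; right.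
    by apply/exists_inP; exists w => //; move: wt; rewrite inE => /andP[].
  - by move=> t Jt t0; apply: acyclic_union_flag => //; rewrite setU0 RJ.
(* Elements that are positive at some member of the flag s. *)
pose P (s : {set signvec E}) := [set u in W | [exists f in s, f u == Pos]].
have [Psi [Psi0 sPsi bPsi]] : exists F : {set signvec E} -> {ffun {set E} -> bool},
   [/\ F set0 = pt _, forall s, D s -> supported (partial_transversal U (P s)) #|s| (F s)
    & forall s, D s -> bd (F s) = pull F s].
  apply: acyclic_carrier => //.
  - by rewrite /partial_transversal sub0set; apply/forallP => i; rewrite set0I cards0.
  - move=> s f Ds fs t /andP[tP h]; rewrite /partial_transversal h andbT.
    apply: subset_trans tP _; apply/subsetP => x; rewrite !inE => /andP[-> /exists_inP[g]].
    by rewrite inE => /andP[_ gs] gx; apply/exists_inP; exists g.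
  - move=> s Ds s0; apply: acyclic_partial_transversal => //.
    rewrite prednK ?card_gt0 //; apply: leq_trans (card_flag Ds) _.
    apply: leq_trans rank_le _; have [f fs] := set0Pn _ s0.
    have Rf : f \in region O v0 set0 set0.
      by case/andP: Ds => /subsetP/(_ _ fs).
    apply: leq_trans (pos_colours f Rf) _; apply/subset_leq_card/subsetP => i.
    rewrite !inE => /set0Pn[x]; rewrite !inE => /andP[/andP[xW fx] xi].
    apply/set0Pn; exists x; rewrite !inE xW xi andbT; apply/exists_inP.
    by exists f.
pose G s := extend Phi (Psi s).
have Psi_J s t : D s -> Psi s t -> J t.
  move=> Ds /(sPsi s Ds)[/andP[tP h] _]; rewrite /J /partial_transversal h andbT.
  by apply: subset_trans tP _; apply/subsetP => x; rewrite inE => /andP[].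
have sG s : D s -> supported D #|s| (G s).
  move=> Ds; apply: supported_sum => t Pt; have Jt := Psi_J s t Ds Pt.
  have [_ <-] := sPsi s Ds t Pt.
  by move=> s' /(sPhi t Jt)[/andP[]].
have bG s : D s -> bd (G s) = pull G s.
  move=> Ds; rewrite /G bd_extend.
  transitivity (extend (pull Phi) (Psi s)).
    by apply: eq_bigr => t Pt; apply/bPhi/(Psi_J s).
  by rewrite extend_pull bPsi // /pull extend_sum.
have RD n : acyclic_at D n by apply/acyclic_region/RJ.
(* Only the empty flag contributes to the trace, and it contributes 1. *)
have := trace_acyclic_eq0 dD RD sG bG; rewrite (bigD1 set0) /=; last exact: flag0.
rewrite /G Psi0 extend_pt Phi0 ffunE eqxx big1 // => s /andP[Ds s0].
apply/negbTE; rewrite sum_ffunE; apply/negP => /sum_bool_true[t Pt Ft].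
have [/andP[/subsetP tP _] _] := sPsi s Ds t Pt.
have [/andP[_]] := sPhi t (Psi_J s t Ds Pt) s Ft.
rewrite (negPf s0) => /exists_inP[u ut /subsetP su] _.
have := tP u ut; rewrite inE => /andP[_ /exists_inP[f fs /eqP fu]].
have /regionP[_ _ /(_ u) + _] := su f fs.
by rewrite inE eqxx fu => /(_ isT).
Qed.
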